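(* Let $a>b>c>0$ and let $M_1,M_2$ be positive integers. A closed sampling, consisting of $2M_1$ and $2M_2$ lines of curvature respectively, of a web of diagonally related nets of lines of curvature and circular cross sections on an ellipsoid $\mathcal E$ of the family associated with $a,b,c$ exists if and only if $$\sqrt{\frac{a-b}{a-c}}=\cos\frac{M_2\pi}{2(M_1+M_2)} .$$
   Context: The ellipsoid is a member $\mathcal E=\mathcal E(s_3)$ of the family $\frac{b-c}{a-c}\frac{x^2}{\cos^2s_3}+y^2+\frac{a-b}{a-c}\frac{z^2}{\sin^2s_3}=1$ ($s_3$ fixed, $\sin s_3\cos s_3\ne0$, $\mathcal E$ not a sphere). Its halves $y\ge0$ and $y\le0$ have the curvature line parametrizations on $[-s_1^0,s_1^0]\times[-s_2^0,s_2^0]$ $$x=\tfrac{a-c}{\sqrt{(a-b)(b-c)}}\sin s_1\cos s_2\cos s_3,\quad y=\pm\sqrt{\tfrac{a-b}{b-c}}\sqrt{1-\tfrac{a-c}{a-b}\sin^2s_1}\sqrt{\tfrac{a-c}{a-b}\cos^2s_2-1},\quad z=\tfrac{a-c}{\sqrt{(a-b)(b-c)}}\cos s_1\sin s_2\sin s_3,$$ with $s_1^0=\sin^{-1}\sqrt{\frac{a-b}{a-c}}$, $s_2^0=\cos^{-1}\sqrt{\frac{a-b}{a-c}}$, for which the curves $s_1\pm s_2=\mathrm{const}$ are the circular cross sections. The web consists of the net of lines of curvature $s_1=\mathrm{const}$, $s_2=\mathrm{const}$ and the diagonal net of circles $s_1\pm s_2=\mathrm{const}$. A closed sampling of this web with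 $2M_2$ lines of curvature in $s_1$-direction and $2M_1$ lines of curvature in $s_2$-direction (counted over both halves of the ellipsoid) is a subdivision of the parameter rectangle of each half by coordinate lines with the same constant step size in both directions, such that the side $[-s_1^0,s_1^0]$ is divided into exactly $M_1$ steps and the side $[-s_2^0,s_2^0]$ into exactly $M_2$ steps (so that the diagonals of the resulting squares are circular cross sections). *)

(* Defs.v *)
From Stdlib Require Import Reals List.
From Coquelicot Require Import Coquelicot.
Open Scope R_scope.

(** * Surfaces and curves in Euclidean 3-space *)

Record point : Type := Point { px : R; py : R; pz : R }.

Definition dot (p q : point) : R := px p * px q + py p * py q + pz p * pz q.

Definition scale (k : R) (p : point) : point :=
  Point (k * px p) (k * py p) (k * pz p).

Definition sub (p q : point) : point :=
  Point (px p - px q) (py p - py q) (pz p - pz q).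

Definition origin : point := Point 0 0 0.

Definition sphere (q : point) (r : R) (p : point) : Prop :=
  dot (sub p q) (sub p q) = r ^ 2.

Definition is_sphere (E : point -> Prop) : Prop :=
  exists (q : point) (r : R), 0 < r /\ forall p, E p <-> sphere q r p.

Definition plane (n : point) (d : R) (p : point) : Prop := dot n p = d.

(** [C] is a planar section of [E] and is a circle of positive radius; the
    circle is the intersection of the plane with a sphere centred on it. *)
Definition circular_cross_section (E C : point -> Prop) : Prop :=
  exists (n : point) (d : R) (q : point) (r : R),
    n <> origin /\ plane n d q /\ 0 < r /\
    (forall p, C p <-> E p /\ plane n d p) /\
    (forall p, C p <-> plane n d p /\ sphere q r p).

Definition is_velocity (g : R -> point) (t : R) (v : point) : Prop :=
  is_derive (fun s => px (g s)) t (px v) /\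
  is_derive (fun s => py (g s)) t (py v) /\
  is_derive (fun s => pz (g s)) t (pz v).

(** A regular curve [g] on the surface [E], parametrized over the open interval
    (l, r), whose velocity is everywhere an eigenvector of the differential of
    the unit normal field [nu]: d nu (g') = (nu o g)' = k g'. *)
Definition line_of_curvature (E : point -> Prop) (nu : point -> point)
    (g : R -> point) (l r : R) : Prop :=
  forall t, l < t < r ->
    E (g t) /\
    exists (v : point) (k : R),
      v <> origin /\ is_velocity g t v /\
      is_velocity (fun s => nu (g s)) t (scale k v).

(** * The ellipsoids and their curvature line parametrization *)

Definition ellipsoid (a b c s3 : R) (p : point) : Prop :=
  (b - c) / (a - c) * ((px p) ^ 2 / (cos s3) ^ 2) + (py p) ^ 2
  + (a - b) / (a - c) * ((pz p) ^ 2 / (sin s3) ^ 2) = 1.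

(** Half the gradient of the quadratic form defining [ellipsoid]. *)
Definition ellipsoid_normal (a b c s3 : R) (p : point) : point :=
  Point ((b - c) / (a - c) * (px p / (cos s3) ^ 2))
        (py p)
        ((a - b) / (a - c) * (pz p / (sin s3) ^ 2)).

Definition ellipsoid_unit_normal (a b c s3 : R) (p : point) : point :=
  let n := ellipsoid_normal a b c s3 p in scale (/ sqrt (dot n n)) n.

Definition s1max (a b c : R) : R := asin (sqrt ((a - b) / (a - c))).
Definition s2max (a b c : R) : R := acos (sqrt ((a - b) / (a - c))).

(** [true] is the half y >= 0, [false] the half y <= 0. *)
Definition half_sign (e : bool) : R := if e then 1 else -1.

Definition web_param (a b c s3 : R) (e : bool) (s1 s2 : R) : point :=
  Point
    ((a - c) / sqrt ((a - b) * (b - c)) * sin s1 * cos s2 * cos s3)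
    (half_sign e * (sqrt ((a - b) / (b - c))
       * sqrt (1 - (a - c) / (a - b) * (sin s1) ^ 2)
       * sqrt ((a - c) / (a - b) * (cos s2) ^ 2 - 1)))
    ((a - c) / sqrt ((a - b) * (b - c)) * cos s1 * sin s2 * sin s3).

(** * Closed samplings *)

Definition subdivision (l r h : R) (n : nat) (u : nat -> R) : Prop :=
  u 0%nat = l /\ u n = r /\ forall i, (i < n)%nat -> u (S i) - u i = h.

Definition arc (g : R -> point) (l r : R) (p : point) : Prop :=
  exists t, l <= t <= r /\ p = g t.

Definition has_card {T : Type} (A : T -> Prop) (n : nat) : Prop :=
  exists L : list T, NoDup L /\ length L = n /\ forall x, In x L <-> A x.

(** The arcs s1 = u i (resp. s2 = v j), on both halves, as point sets. An arc on
    the common boundary y = 0 of the two halves is therefore counted once. *)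
Definition s1_const_arcs (a b c s3 : R) (M1 : nat) (u : nat -> R)
    (C : point -> Prop) : Prop :=
  exists (e : bool) (i : nat), (i <= M1)%nat /\
    C = arc (fun s2 => web_param a b c s3 e (u i) s2)
            (- s2max a b c) (s2max a b c).

Definition s2_const_arcs (a b c s3 : R) (M2 : nat) (v : nat -> R)
    (C : point -> Prop) : Prop :=
  exists (e : bool) (j : nat), (j <= M2)%nat /\
    C = arc (fun s1 => web_param a b c s3 e s1 (v j))
            (- s1max a b c) (s1max a b c).

(** The parameter rectangle of each half is cut by the lines s1 = u i, s2 = v j
    into M1 x M2 squares of side [h]. The lines run in s2-direction (2 M1 of
    them) and in s1-direction (2 M2 of them). *)
Record closed_sampling (a b c s3 : R) (M1 M2 : nat)
    (h : R) (u v : nat -> R) : Prop := {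
  cs_step : 0 < h;
  cs_side1 : subdivision (- s1max a b c) (s1max a b c) h M1 u;
  cs_side2 : subdivision (- s2max a b c) (s2max a b c) h M2 v;
  cs_curvature1 : forall (e : bool) (i : nat), (i <= M1)%nat ->
    line_of_curvature (ellipsoid a b c s3) (ellipsoid_unit_normal a b c s3)
      (fun s2 => web_param a b c s3 e (u i) s2)
      (- s2max a b c) (s2max a b c);
  cs_curvature2 : forall (e : bool) (j : nat), (j <= M2)%nat ->
    line_of_curvature (ellipsoid a b c s3) (ellipsoid_unit_normal a b c s3)
      (fun s1 => web_param a b c s3 e s1 (v j))
      (- s1max a b c) (s1max a b c);
  cs_count1 : has_card (s1_const_arcs a b c s3 M1 u) (2 * M1);
  cs_count2 : has_card (s2_const_arcs a b c s3 M2 v) (2 * M2);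
  cs_diagonal_minus : forall (e : bool) (i j : nat),
    (i < M1)%nat -> (j < M2)%nat ->
    exists C, circular_cross_section (ellipsoid a b c s3) C /\
      forall t, 0 <= t <= h -> C (web_param a b c s3 e (u i + t) (v j + t));
  cs_diagonal_plus : forall (e : bool) (i j : nat),
    (i < M1)%nat -> (j < M2)%nat ->
    exists C, circular_cross_section (ellipsoid a b c s3) C /\
      forall t, 0 <= t <= h -> C (web_param a b c s3 e (u i + t) (v (S j) - t))
}.

(* Main.v *)
Require Import Defs.
From Stdlib Require Import Reals List.
From Coquelicot Require Import Coquelicot.
From Stdlib Require Import Lra Lia FunctionalExtensionality.
Open Scope R_scope.

(** Write alpha, beta for the half sides [s1max], [s2max] of the parameter
    rectangle. They are the arcsine and the arccosine of the same number
    m = sqrt ((a-b)/(a-c)), so alpha + beta = PI/2.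

    If M1 steps h fill [-alpha, alpha] and M2 steps h fill [-beta, beta], then
    M1 h + M2 h = PI, hence beta = M2 h / 2 = M2 PI / (2 (M1 + M2)) and
    m = cos beta is the stated condition. Conversely the condition gives beta
    back, and h = PI / (M1 + M2) then divides both sides exactly; it remains to
    see that every such equal subdivision is a closed sampling
    ([common_step_closed_sampling]), which is the geometric part.

    Lines of curvature. Along a parameter curve x and z are multiples of the
    sine and the cosine of the parameter, and y is a multiple of a radical of
    the same quantities. Let n be the (unnormalized) gradient. One finds
    n' = kappa g' + mu n with explicit kappa and mu ([principal_direction]);
    as g' is tangent to the surface, normalizing n removes the mu-part
    ([normalized_velocity]), which leaves the eigenvector equation of Rodrigues.

    Circles. Since (a-b) + (b-c) = a-c, the equation of the ellipsoid minus
    that of the unit sphere is a multiple of (sin^2 s3) x^2 - (cos^2 s3) z^2, a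
    product of two linear forms. On a plane where one of the factors is constant
    the quadric therefore cuts out the same points as a sphere
    ([diagonal_section_circle]). The constant value is a multiple of
    sin (s1 -+ s2) by the addition theorem ([diagonal_plane]), and the radius
    turns out to be cos (s1 -+ s2), positive on every diagonal because
    |s1 -+ s2| <= PI/2 - h there.

    Counting. The M1 + 1 parameter lines on two halves would give 2 M1 + 2 arcs,
    but the two halves share the first and the last one, where y = 0; all other
    arcs are distinct, as the midpoint of an arc determines it
    ([s1_const_arc_determined_by_midpoint]). *)

(** * Principal directions by Rodrigues' formula *)

(** The derivative of m / |m| is the part of m' / |m| orthogonal to m. When m'
    is a combination of m and of a vector v orthogonal to m, only v survives. *)
Lemma normalized_velocity (m : R -> point) (t kappa mu : R) (v w : point) :
  is_velocity m t w ->
  px w = kappa * px v + mu * px (m t) ->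
  py w = kappa * py v + mu * py (m t) ->
  pz w = kappa * pz v + mu * pz (m t) ->
  0 < dot (m t) (m t) ->
  dot (m t) v = 0 ->
  is_velocity (fun s => scale (/ sqrt (dot (m s) (m s))) (m s)) t
    (scale (kappa / sqrt (dot (m t) (m t))) v).
Proof.
  intros (Dx & Dy & Dz) Hx Hy Hz Hpos Hperp.
  assert (Hsq : is_derive (fun s => dot (m s) (m s)) t
                  (2 * (mu * dot (m t) (m t)))).
  { unfold dot in *.
    replace (2 * _) with
      ((px w * px (m t) + px (m t) * px w + (py w * py (m t) + py (m t) * py w))
       + (pz w * pz (m t) + pz (m t) * pz w)).
    - apply (is_derive_plus (V := R_NormedModule));
        [apply (is_derive_plus (V := R_NormedModule))|];
        apply (is_derive_mult (K := R_AbsRing)); auto; intros; apply Rmult_comm.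
    - rewrite Hx, Hy, Hz.
      replace (2 * _) with (2 * (mu * (px (m t) * px (m t) + py (m t) * py (m t) + pz (m t) * pz (m t)))
        + 2 * kappa * (px (m t) * px v + py (m t) * py v + pz (m t) * pz v))
        by (rewrite Hperp; ring).
      ring. }
  assert (Hr : 0 < sqrt (dot (m t) (m t))) by now apply sqrt_lt_R0.
  assert (Hinv : is_derive (fun s => / sqrt (dot (m s) (m s))) t
                   (- mu / sqrt (dot (m t) (m t)))).
  { replace (- mu / _) with
      (- (2 * (mu * dot (m t) (m t)) / (2 * sqrt (dot (m t) (m t))))
         / (sqrt (dot (m t) (m t))) ^ 2).
    - apply (is_derive_inv (fun s => sqrt (dot (m s) (m s)))); [|lra].
      now apply (is_derive_sqrt (fun s => dot (m s) (m s)) t).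
    - pose proof (sqrt_sqrt (dot (m t) (m t)) (Rlt_le _ _ Hpos)) as Hqq.
      set (q := sqrt _) in *. rewrite <- Hqq. field. lra. }
  assert (Hcomp : forall f df k, is_derive f t df ->
            df = kappa * k + mu * f t ->
            is_derive (fun s => / sqrt (dot (m s) (m s)) * f s) t
              (kappa / sqrt (dot (m t) (m t)) * k)).
  { intros f df k Hf Hdf.
    replace (kappa / _ * k) with
      (- mu / sqrt (dot (m t) (m t)) * f t + / sqrt (dot (m t) (m t)) * df)
      by (rewrite Hdf; field; lra).
    apply (is_derive_mult (K := R_AbsRing) (fun s => / sqrt (dot (m s) (m s))) f t); auto. intros; apply Rmult_comm. }
  refine (conj _ (conj _ _)).
  - now apply (Hcomp (fun s => px (m s)) (px w) (px v)).
  - now apply (Hcomp (fun s => py (m s)) (py w) (py v)).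
  - now apply (Hcomp (fun s => pz (m s)) (pz w) (pz v)).
Qed.

(** Euler's identity for the quadratic form gives (normal at p) . p = 1 on the
    ellipsoid, so the normal cannot vanish. *)
Lemma ellipsoid_normal_nonzero (a b c s3 : R) (p : point) :
  ellipsoid a b c s3 p ->
  0 < dot (ellipsoid_normal a b c s3 p) (ellipsoid_normal a b c s3 p).
Proof.
  intros Hp.
  assert (Heuler : dot (ellipsoid_normal a b c s3 p) p = 1).
  { rewrite <- Hp. unfold dot, ellipsoid_normal, Rdiv; simpl. ring. }
  revert Heuler. generalize (ellipsoid_normal a b c s3 p). intros n Hn.
  unfold dot in *. apply Rnot_le_lt. intros Hle.
  assert (px n = 0) by nra. assert (py n = 0) by nra. assert (pz n = 0) by nra.
  nra.
Qed.

(** The normal field n is linear in the position, so n applied to the velocity v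
    is the derivative of n along the curve. It suffices to find n v as a
    combination of v and the normal. *)
Lemma rodrigues_formula (a b c s3 : R) (g : R -> point) (t kappa mu : R) (v : point) :
  let n := ellipsoid_normal a b c s3 in
  ellipsoid a b c s3 (g t) ->
  is_velocity g t v ->
  dot (n (g t)) v = 0 ->
  px (n v) = kappa * px v + mu * px (n (g t)) ->
  py (n v) = kappa * py v + mu * py (n (g t)) ->
  pz (n v) = kappa * pz v + mu * pz (n (g t)) ->
  exists k, is_velocity (fun s => ellipsoid_unit_normal a b c s3 (g s)) t
              (scale k v).
Proof.
  intros n HE (Dx & Dy & Dz) Htan Hx Hy Hz. eexists.
  apply (normalized_velocity (fun s => n (g s)) t kappa mu v (n v)); auto.
  - refine (conj _ (conj _ _)); simpl; unfold Rdiv; auto.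
    + apply (is_derive_scal (fun s => px (g s) * / cos s3 ^ 2)).
      apply (is_derive_scal_l (V := R_NormedModule) (fun s => px (g s))); auto.
    + apply (is_derive_scal (fun s => pz (g s) * / sin s3 ^ 2)).
      apply (is_derive_scal_l (V := R_NormedModule) (fun s => pz (g s))); auto.
  - now apply ellipsoid_normal_nonzero.
Qed.

(** * The parameter rectangle *)

Lemma modulus_bounds (a b c : R) : a > b -> b > c ->
  0 < sqrt ((a - b) / (a - c)) < 1.
Proof.
  intros hab hbc.
  assert (0 < (a - b) / (a - c)) by (apply Rdiv_lt_0_compat; lra).
  split; [now apply sqrt_lt_R0|].
  rewrite <- sqrt_1. apply sqrt_lt_1; try lra.
  apply Rmult_lt_reg_r with (a - c); [lra|]. field_simplify; lra.
Qed.

Lemma s1max_sin (a b c : R) : a > b -> b > c ->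
  sin (s1max a b c) = sqrt ((a - b) / (a - c)).
Proof.
  intros hab hbc. pose proof (modulus_bounds a b c hab hbc).
  apply sin_asin. lra.
Qed.

Lemma s1max_bounds (a b c : R) : a > b -> b > c -> 0 < s1max a b c < PI / 2.
Proof.
  intros hab hbc. pose proof (modulus_bounds a b c hab hbc) as Hm.
  pose proof (asin_bound_lt (sqrt ((a - b) / (a - c)))) as Hb.
  fold (s1max a b c) in Hb. split; [|apply Hb; lra].
  apply sin_increasing_0; try lra.
  rewrite sin_0, s1max_sin by assumption. lra.
Qed.

Lemma s1max_plus_s2max (a b c : R) : a > b -> b > c ->
  s1max a b c + s2max a b c = PI / 2.
Proof.
  intros hab hbc. pose proof (modulus_bounds a b c hab hbc).
  unfold s1max, s2max. rewrite acos_asin by lra. ring.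
Qed.

Lemma s2max_bounds (a b c : R) : a > b -> b > c -> 0 < s2max a b c < PI / 2.
Proof.
  intros hab hbc. pose proof (s1max_bounds a b c hab hbc).
  pose proof (s1max_plus_s2max a b c hab hbc). lra.
Qed.

(** Both radicands in the y-coordinate factor through
    sin^2 x - sin^2 y = sin (x - y) sin (x + y). This shows their sign on the
    parameter rectangle and their zeros on its boundary without case
    distinctions on the sign of the parameter. *)
Lemma radicand1_factored (a b c s : R) : a > b -> b > c ->
  1 - (a - c) / (a - b) * sin s ^ 2 =
  (a - c) / (a - b) * (sin (s1max a b c - s) * sin (s1max a b c + s)).
Proof.
  intros hab hbc.
  assert (Hm : sin (s1max a b c) ^ 2 = (a - b) / (a - c)).
  { rewrite s1max_sin by assumption. apply pow2_sqrt.
    apply Rlt_le, Rdiv_lt_0_compat; lra. }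
  replace (sin (s1max a b c - s) * sin (s1max a b c + s))
    with (sin (s1max a b c) ^ 2 - sin s ^ 2).
  - rewrite Hm. field. lra.
  - rewrite sin_minus, sin_plus.
    pose proof (sin2_cos2 s). pose proof (sin2_cos2 (s1max a b c)).
    unfold Rsqr in *. nra.
Qed.

Lemma radicand2_factored (a b c s : R) : a > b -> b > c ->
  (a - c) / (a - b) * cos s ^ 2 - 1 =
  (a - c) / (a - b) * (sin (s2max a b c - s) * sin (s2max a b c + s)).
Proof.
  intros hab hbc.
  pose proof (s1max_plus_s2max a b c hab hbc).
  replace (s2max a b c - s) with (PI - (s1max a b c + (PI / 2 + s))) by lra.
  replace (s2max a b c + s) with (- (s1max a b c - (PI / 2 + s))) by lra.
  rewrite sin_PI_x, sin_neg.
  transitivity (- ((a - c) / (a - b) * (sin (s1max a b c - (PI / 2 + s)) *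
     sin (s1max a b c + (PI / 2 + s))))); [|ring].
  rewrite <- radicand1_factored by assumption.
  rewrite <- cos_sin. ring.
Qed.

Section Ranges.
Context (a b c : R) (hab : a > b) (hbc : b > c).

Lemma ratio_pos : 0 < (a - c) / (a - b).
Proof. apply Rdiv_lt_0_compat; lra. Qed.

Lemma radicand1_ge0 (s : R) : - s1max a b c <= s <= s1max a b c ->
  0 <= 1 - (a - c) / (a - b) * sin s ^ 2.
Proof.
  intros Hs. rewrite radicand1_factored by assumption.
  pose proof (s1max_bounds a b c hab hbc). pose proof ratio_pos.
  apply Rmult_le_pos; [lra|]. apply Rmult_le_pos; apply sin_ge_0; lra.
Qed.

Lemma radicand1_gt0 (s : R) : - s1max a b c < s < s1max a b c ->
  0 < 1 - (a - c) / (a - b) * sin s ^ 2.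
Proof.
  intros Hs. rewrite radicand1_factored by assumption.
  pose proof (s1max_bounds a b c hab hbc). pose proof ratio_pos.
  apply Rmult_lt_0_compat; [lra|]. apply Rmult_lt_0_compat; apply sin_gt_0; lra.
Qed.

Lemma radicand2_ge0 (s : R) : - s2max a b c <= s <= s2max a b c ->
  0 <= (a - c) / (a - b) * cos s ^ 2 - 1.
Proof.
  intros Hs. rewrite radicand2_factored by assumption.
  pose proof (s2max_bounds a b c hab hbc). pose proof ratio_pos.
  apply Rmult_le_pos; [lra|]. apply Rmult_le_pos; apply sin_ge_0; lra.
Qed.

Lemma radicand2_gt0 (s : R) : - s2max a b c < s < s2max a b c ->
  0 < (a - c) / (a - b) * cos s ^ 2 - 1.
Proof.
  intros Hs. rewrite radicand2_factored by assumption.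
  pose proof (s2max_bounds a b c hab hbc). pose proof ratio_pos.
  apply Rmult_lt_0_compat; [lra|]. apply Rmult_lt_0_compat; apply sin_gt_0; lra.
Qed.
End Ranges.

(** * The parametrized curves as lines of curvature *)

(** The factor common to x and z in the parametrization. *)
Definition amplitude (a b c : R) : R := (a - c) / sqrt ((a - b) * (b - c)).

Lemma amplitude_pos (a b c : R) : a > b -> b > c -> 0 < amplitude a b c.
Proof.
  intros hab hbc. apply Rdiv_lt_0_compat; [lra|].
  apply sqrt_lt_R0, Rmult_lt_0_compat; lra.
Qed.

Lemma amplitude_sq (a b c : R) : a > b -> b > c ->
  amplitude a b c ^ 2 = (a - c) ^ 2 / ((a - b) * (b - c)).
Proof.
  intros hab hbc. unfold amplitude.
  assert (0 < (a - b) * (b - c)) by (apply Rmult_lt_0_compat; lra).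
  unfold Rdiv. rewrite Rpow_mult_distr, pow_inv, pow2_sqrt by lra. reflexivity.
Qed.

Lemma half_sign_sq (e : bool) : half_sign e ^ 2 = 1.
Proof. destruct e; simpl; ring. Qed.

Lemma cos2_sin2 (x : R) : cos x ^ 2 = 1 - sin x ^ 2.
Proof. pose proof (sin2_cos2 x). unfold Rsqr in *. lra. Qed.

(** Both families of parameter curves have this form at a point: with (C, S) =
    (cos t, sin t) for the s2-curves and (C, S) = (sin t, - cos t) for the
    s1-curves. In either case y^2 is a constant multiple of
    (a-c)/(a-b) C^2 - 1, whence the hypothesis on the logarithmic derivative
    of y. The three coordinates of n' = kappa v + mu n then reduce to
    C^2 + S^2 = 1 and to the identity sin^2 s3 + cos^2 s3 = 1. *)
Lemma principal_direction (a b c s3 : R) (g : R -> point) (t : R)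
    (C S al ga y y' : R) :
  a > b -> b > c -> sin s3 <> 0 -> cos s3 <> 0 ->
  C ^ 2 + S ^ 2 = 1 ->
  g t = Point (al * C) y (ga * S) ->
  let v := Point (- al * S) y' (ga * C) in
  is_velocity g t v ->
  ellipsoid a b c s3 (g t) ->
  dot (ellipsoid_normal a b c s3 (g t)) v = 0 ->
  (a - c) / (a - b) * C ^ 2 - 1 <> 0 ->
  y' = - ((a - c) / (a - b) * C * S) / ((a - c) / (a - b) * C ^ 2 - 1) * y ->
  exists k, is_velocity (fun s => ellipsoid_unit_normal a b c s3 (g s)) t
    (scale k v).
Proof.
  intros hab hbc Hs Hc HCS Hg v Hv HE Htan HR Hy.
  assert (HS : S ^ 2 = 1 - C ^ 2) by lra.
  pose proof (sin2_cos2 s3) as H3. rewrite !Rsqr_pow2 in H3.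
  assert (Hc3 : cos s3 ^ 2 = 1 - sin s3 ^ 2) by lra.
  (* The squared length of the normal splits as a product of one function of
     s1 and one of s2. D is, up to a constant, the factor that depends on t;
     mu is half its logarithmic derivative. *)
  set (D := (a - b) * cos s3 ^ 2 * S ^ 2 + (b - c) * sin s3 ^ 2 * C ^ 2).
  assert (HD : 0 < D).
  { assert (0 < cos s3 ^ 2) by nra. assert (0 < sin s3 ^ 2) by nra.
    assert (0 < (a - b) * cos s3 ^ 2) by nra.
    assert (0 < (b - c) * sin s3 ^ 2) by nra.
    unfold D. assert (0 <= C ^ 2) by nra. assert (0 <= S ^ 2) by nra.
    destruct (Rle_lt_dec (C ^ 2) (1 / 2)); nra. }
  assert (HR' : (a - c) * C ^ 2 - (a - b) <> 0).
  { intros Hz. apply HR. replace ((a - c) / (a - b) * C ^ 2 - 1)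
      with (((a - c) * C ^ 2 - (a - b)) / (a - b)) by (field; lra).
    rewrite Hz. unfold Rdiv. ring. }
  set (k := (a - b) * (b - c) / ((a - c) * D)).
  set (m := S * C * ((a - b) * cos s3 ^ 2 - (b - c) * sin s3 ^ 2) / D).
  apply (rodrigues_formula a b c s3 g t k m v); auto;
    rewrite Hg; unfold ellipsoid_normal, v; cbn [px py pz].
  - unfold k, m, D. field [HS Hc3]. fold D. lra.
  - rewrite Hy. unfold k, m, D. field [HS Hc3]. fold D. lra.
  - unfold k, m, D. field [HS Hc3]. fold D. lra.
Qed.

Section Web.
Context (a b c s3 : R) (hab : a > b) (hbc : b > c) (hs3 : sin s3 * cos s3 <> 0).

Lemma web_param_on_ellipsoid (e : bool) (s1 s2 : R) :
  0 <= 1 - (a - c) / (a - b) * sin s1 ^ 2 ->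
  0 <= (a - c) / (a - b) * cos s2 ^ 2 - 1 ->
  ellipsoid a b c s3 (web_param a b c s3 e s1 s2).
Proof.
  intros H1 H2. unfold ellipsoid, web_param. fold (amplitude a b c).
  cbn [px py pz]. rewrite !Rpow_mult_distr, half_sign_sq.
  rewrite (pow2_sqrt _ H1), (pow2_sqrt _ H2).
  rewrite pow2_sqrt by (apply Rlt_le, Rdiv_lt_0_compat; lra).
  rewrite amplitude_sq by assumption.
  assert (sin s3 <> 0 /\ cos s3 <> 0) as [].
  { split; intros Hz; apply hs3; rewrite Hz; ring. }
  rewrite (cos2_sin2 s1), (cos2_sin2 s2). field. repeat split; lra.
Qed.

Lemma sin_cos_s3_neq0 : sin s3 <> 0 /\ cos s3 <> 0.
Proof. split; intros Hz; apply hs3; rewrite Hz; ring. Qed.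

Lemma s1_const_line_of_curvature (e : bool) (s1 : R) :
  - s1max a b c <= s1 <= s1max a b c ->
  line_of_curvature (ellipsoid a b c s3) (ellipsoid_unit_normal a b c s3)
    (fun s2 => web_param a b c s3 e s1 s2) (- s2max a b c) (s2max a b c).
Proof.
  intros Hs1 t Ht.
  pose proof (s1max_bounds a b c hab hbc). pose proof (s2max_bounds a b c hab hbc).
  pose proof (radicand1_ge0 a b c hab hbc s1 Hs1) as HU.
  pose proof (radicand2_gt0 a b c hab hbc t Ht) as HV.
  destruct sin_cos_s3_neq0 as [Hs Hc].
  pose proof (amplitude_pos a b c hab hbc) as HK.
  assert (HE : ellipsoid a b c s3 (web_param a b c s3 e s1 t)).
  { apply web_param_on_ellipsoid; lra. }
  split; [exact HE|].
  set (Y := sqrt ((a - c) / (a - b) * cos t ^ 2 - 1)).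
  assert (HY : 0 < Y) by now apply sqrt_lt_R0.
  assert (HY2 : Y ^ 2 = (a - c) / (a - b) * cos t ^ 2 - 1) by (apply pow2_sqrt; lra).
  set (al := amplitude a b c * sin s1 * cos s3).
  set (ga := amplitude a b c * cos s1 * sin s3).
  set (be := half_sign e * (sqrt ((a - b) / (b - c))
    * sqrt (1 - (a - c) / (a - b) * sin s1 ^ 2))).
  set (v := Point (- al * sin t)
    (be * (- ((a - c) / (a - b) * cos t * sin t) / Y)) (ga * cos t)).
  assert (Hv : is_velocity (fun s2 => web_param a b c s3 e s1 s2) t v).
  { unfold web_param. fold (amplitude a b c). refine (conj _ (conj _ _)); cbn [px py pz v].
    - auto_derive; [easy|]. unfold al. ring.
    - auto_derive; [exact HV|].
      assert (HYs : Y <> 0) by lra.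
      unfold be, Y, Rminus in *; cbn [pow] in *. field. split; [lra|exact HYs].
    - auto_derive; [easy|]. unfold ga. ring. }
  assert (Hbe : be ^ 2 = (a - b) / (b - c) * (1 - (a - c) / (a - b) * sin s1 ^ 2)).
  { unfold be. rewrite !Rpow_mult_distr, half_sign_sq, (pow2_sqrt _ HU), pow2_sqrt.
    - ring.
    - apply Rlt_le, Rdiv_lt_0_compat; lra. }
  assert (Hg : web_param a b c s3 e s1 t = Point (al * cos t) (be * Y) (ga * sin t)).
  { unfold web_param, al, be, ga, Y, amplitude. f_equal; ring. }
  destruct (principal_direction a b c s3 (fun s2 => web_param a b c s3 e s1 s2) t
    (cos t) (sin t) al ga (be * Y) (py v)) as [k Hk]; auto.
  - rewrite cos2_sin2. ring.
  - cbv beta. rewrite Hg. unfold ellipsoid_normal, dot; cbn [px py pz v].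
    replace (be * Y * (be * _)) with
      (be ^ 2 * - ((a - c) / (a - b) * cos t * sin t)) by (field; lra).
    rewrite Hbe. unfold al, ga.
    pose proof (amplitude_sq a b c hab hbc) as HK2.
    transitivity (amplitude a b c ^ 2 * (sin t * cos t *
      ((a - b) / (a - c) * cos s1 ^ 2 - (b - c) / (a - c) * sin s1 ^ 2))
      - (a - b) / (b - c) * (1 - (a - c) / (a - b) * sin s1 ^ 2)
        * ((a - c) / (a - b) * cos t * sin t)).
    + field. lra.
    + rewrite HK2. field [(cos2_sin2 s1)]. lra.
  - lra.
  - cbn [py v]. rewrite <- HY2. field. lra.
  - exists v, k. refine (conj _ (conj Hv Hk)).
    assert (Hc1 : 0 < cos s1) by (apply cos_gt_0; lra).
    assert (Hct : 0 < cos t) by (apply cos_gt_0; lra).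
    intros Hz. apply (f_equal pz) in Hz. cbn [pz v origin] in Hz.
    revert Hz. unfold ga.
    repeat (apply Rmult_integral_contrapositive_currified; [|lra]). lra.
Qed.

Lemma s2_const_line_of_curvature (e : bool) (s2 : R) :
  - s2max a b c <= s2 <= s2max a b c ->
  line_of_curvature (ellipsoid a b c s3) (ellipsoid_unit_normal a b c s3)
    (fun s1 => web_param a b c s3 e s1 s2) (- s1max a b c) (s1max a b c).
Proof.
  intros Hs2 t Ht.
  pose proof (s1max_bounds a b c hab hbc). pose proof (s2max_bounds a b c hab hbc).
  pose proof (radicand2_ge0 a b c hab hbc s2 Hs2) as HU.
  pose proof (radicand1_gt0 a b c hab hbc t Ht) as HV.
  destruct sin_cos_s3_neq0 as [Hs Hc].
  pose proof (amplitude_pos a b c hab hbc) as HK.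
  assert (HE : ellipsoid a b c s3 (web_param a b c s3 e t s2)).
  { apply web_param_on_ellipsoid; lra. }
  split; [exact HE|].
  set (Y := sqrt (1 - (a - c) / (a - b) * sin t ^ 2)).
  assert (HY : 0 < Y) by now apply sqrt_lt_R0.
  assert (HY2 : Y ^ 2 = 1 - (a - c) / (a - b) * sin t ^ 2) by (apply pow2_sqrt; lra).
  set (al := amplitude a b c * cos s2 * cos s3).
  set (ga := - (amplitude a b c * sin s2 * sin s3)).
  set (be := half_sign e * (sqrt ((a - b) / (b - c))
    * sqrt ((a - c) / (a - b) * cos s2 ^ 2 - 1))).
  set (v := Point (- al * - cos t)
    (be * (- ((a - c) / (a - b) * cos t * sin t) / Y)) (ga * sin t)).
  assert (Hv : is_velocity (fun s1 => web_param a b c s3 e s1 s2) t v).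
  { unfold web_param. fold (amplitude a b c). refine (conj _ (conj _ _)); cbn [px py pz v].
    - auto_derive; [easy|]. unfold al. ring.
    - auto_derive; [exact HV|].
      assert (HYs : Y <> 0) by lra.
      unfold be, Y, Rminus in *; cbn [pow] in *. field. split; [lra|exact HYs].
    - auto_derive; [easy|]. unfold ga. ring. }
  assert (Hbe : be ^ 2 = (a - b) / (b - c) * ((a - c) / (a - b) * cos s2 ^ 2 - 1)).
  { unfold be. rewrite !Rpow_mult_distr, half_sign_sq, (pow2_sqrt _ HU), pow2_sqrt.
    - ring.
    - apply Rlt_le, Rdiv_lt_0_compat; lra. }
  assert (Hg : web_param a b c s3 e t s2
                = Point (al * sin t) (be * Y) (ga * - cos t)).
  { unfold web_param, al, be, ga, Y, amplitude. f_equal; ring. }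
  (* A quarter turn (C, S) = (sin t, - cos t) moves this family into the form
     of the other one; it changes the sign of the z-amplitude. *)
  destruct (principal_direction a b c s3 (fun s1 => web_param a b c s3 e s1 s2) t
    (sin t) (- cos t) al ga (be * Y) (py v)) as [k Hk]; auto.
  - replace ((- cos t) ^ 2) with (cos t ^ 2) by ring. rewrite cos2_sin2. ring.
  - cbv beta. rewrite Hg. unfold ellipsoid_normal, dot; cbn [px py pz v].
    replace (be * Y * (be * _)) with
      (be ^ 2 * - ((a - c) / (a - b) * cos t * sin t)) by (field; lra).
    rewrite Hbe. unfold al, ga.
    pose proof (amplitude_sq a b c hab hbc) as HK2.
    transitivity (amplitude a b c ^ 2 * (sin t * cos t *
      ((b - c) / (a - c) * cos s2 ^ 2 - (a - b) / (a - c) * sin s2 ^ 2))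
      - (a - b) / (b - c) * ((a - c) / (a - b) * cos s2 ^ 2 - 1)
        * ((a - c) / (a - b) * cos t * sin t)).
    + field. lra.
    + rewrite HK2. field [(cos2_sin2 s2)]. lra.
  - lra.
  - cbn [py v].
    replace ((a - c) / (a - b) * sin t ^ 2 - 1) with (- Y ^ 2) by (rewrite HY2; ring).
    field. lra.
  - exists v, k. refine (conj _ (conj Hv Hk)).
    assert (Hc1 : 0 < cos s2) by (apply cos_gt_0; lra).
    assert (Hct : 0 < cos t) by (apply cos_gt_0; lra).
    intros Hz. apply (f_equal px) in Hz. cbn [px v origin] in Hz.
    replace (- al * - cos t) with (al * cos t) in Hz by ring.
    revert Hz. unfold al.
    repeat (apply Rmult_integral_contrapositive_currified; [|lra]). lra.
Qed.

(** * Circular sections *)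

Lemma diagonal_plane (e : bool) (s1 s2 eps : R) :
  eps = 1 \/ eps = -1 ->
  plane (Point (sin s3) 0 (- eps * cos s3))
    (amplitude a b c * sin s3 * cos s3 * sin (s1 - eps * s2))
    (web_param a b c s3 e s1 s2).
Proof.
  unfold plane, dot, web_param. fold (amplitude a b c). cbn [px py pz].
  intros [-> | ->].
  - rewrite Rmult_1_l, sin_minus. ring.
  - replace (s1 - -1 * s2) with (s1 + s2) by ring. rewrite sin_plus. ring.
Qed.

(** The ellipsoid lies in the pencil spanned by a sphere and the pair of planes
    formed by this plane and a second one: ellipsoid = sphere + l * plane with l
    an affine function of the point. On the plane itself, sphere and ellipsoid
    agree. *)
Lemma diagonal_section_circle (eps delta : R) :
  eps = 1 \/ eps = -1 -> 0 < cos delta ->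
  circular_cross_section (ellipsoid a b c s3) (fun p =>
    ellipsoid a b c s3 p /\
    plane (Point (sin s3) 0 (- eps * cos s3))
      (amplitude a b c * sin s3 * cos s3 * sin delta) p).
Proof.
  intros Heps Hcos. destruct sin_cos_s3_neq0 as [Hs Hc].
  assert (Heps2 : eps ^ 2 = 1) by (destruct Heps as [-> | ->]; ring).
  pose proof (amplitude_sq a b c hab hbc) as HK2.
  set (K := amplitude a b c) in *.
  set (d := K * sin s3 * cos s3 * sin delta).
  (* The centre of the sphere in the pencil that is centred on the plane; for
     this member of the pencil the radius simplifies to cos delta. *)
  set (q := Point (K * sin delta * ((a - b) / (a - c) * cos s3)) 0
                  (- eps * (K * sin delta * ((b - c) / (a - c) * sin s3)))).
  exists (Point (sin s3) 0 (- eps * cos s3)), d, q, (cos delta).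
  assert (Hpencil : forall p, exists l : R,
    (b - c) / (a - c) * (px p ^ 2 / cos s3 ^ 2) + py p ^ 2
      + (a - b) / (a - c) * (pz p ^ 2 / sin s3 ^ 2) - 1
    = dot (sub p q) (sub p q) - cos delta ^ 2
      + l * (dot (Point (sin s3) 0 (- eps * cos s3)) p - d)).
  { intros p.
    (* kap * (sin s3 x - cos s3 z) * (sin s3 x + cos s3 z) is the difference
       of the ellipsoid and the unit sphere. The second summand of l moves the
       centre of the sphere along the normal into the plane. *)
    set (kap := (b - c) / ((a - c) * cos s3 ^ 2 * sin s3 ^ 2) - / sin s3 ^ 2).
    exists (kap * (sin s3 * px p + eps * cos s3 * pz p)
            + 2 * d * (1 + kap * (sin s3 ^ 2 - cos s3 ^ 2) / 2)).
    unfold dot, sub, q, d, kap; cbn [px py pz].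
    rewrite (cos2_sin2 delta).
    field_simplify_eq [(cos2_sin2 s3) Heps2 HK2].
    - field. lra.
    - lra. }
  refine (conj _ (conj _ (conj Hcos (conj _ _)))).
  - intros Hz. apply (f_equal px) in Hz. now apply Hs.
  - unfold plane, dot, q, d; cbn [px py pz].
    transitivity (K * sin delta * sin s3 * cos s3 * ((a - b) / (a - c)
       + eps ^ 2 * ((b - c) / (a - c)))).
    + ring.
    + rewrite Heps2. field. lra.
  - easy.
  - intros p. destruct (Hpencil p) as [l Hl].
    unfold ellipsoid, sphere, plane.
    split; [intros [Hp Hplane] | intros [Hplane Hp]]; split; auto;
      rewrite Hplane in Hl; replace (l * (d - d)) with 0 in Hl by ring; lra.
Qed.
End Web.

(** * Counting the arcs of two halves *)

(** Gluing the two sheets at 0 and at M identifies two of the 2 (M + 1) values. *)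
Lemma has_card_two_sheets {T : Type} (F : bool -> nat -> T) (M : nat) :
  (0 < M)%nat ->
  F true 0%nat = F false 0%nat -> F true M = F false M ->
  (forall e i e' j, (i <= M)%nat -> (j <= M)%nat -> F e i = F e' j ->
     i = j /\ ((0 < i < M)%nat -> e = e')) ->
  has_card (fun C => exists (e : bool) (i : nat), (i <= M)%nat /\ C = F e i)
    (2 * M).
Proof.
  intros HM H0 HMM Hinj.
  exists (map (F true) (seq 0 (S M)) ++ map (F false) (seq 1 (M - 1))).
  split; [|split].
  - apply NoDup_app.
    + apply NoDup_map_NoDup_ForallPairs; [|apply seq_NoDup].
      intros i j Hi Hj HF. apply in_seq in Hi. apply in_seq in Hj.
      apply (Hinj true i true j); auto; lia.
    + apply NoDup_map_NoDup_ForallPairs; [|apply seq_NoDup].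
      intros i j Hi Hj HF. apply in_seq in Hi. apply in_seq in Hj.
      apply (Hinj false i false j); auto; lia.
    + intros C HC HC'.
      apply in_map_iff in HC. destruct HC as (i & <- & Hi).
      apply in_map_iff in HC'. destruct HC' as (j & HF & Hj).
      apply in_seq in Hi. apply in_seq in Hj.
      enough (false = true) by discriminate.
      apply (Hinj false j true i); auto; lia.
  - rewrite length_app, !length_map, !length_seq. lia.
  - intros C. rewrite in_app_iff, !in_map_iff. split.
    + intros [(i & <- & Hi) | (i & <- & Hi)]; apply in_seq in Hi.
      * exists true, i. split; [lia|easy].
      * exists false, i. split; [lia|easy].
    + intros (e & i & Hi & ->). destruct e.
      * left. exists i. rewrite in_seq. split; [easy|lia].
      * destruct (Nat.eq_dec i 0) as [->|Hi0].
        { left. exists 0%nat. rewrite in_seq. split; [easy|lia]. }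
        destruct (Nat.eq_dec i M) as [->|HiM].
        { left. exists M. rewrite in_seq. split; [easy|lia]. }
        right. exists i. rewrite in_seq. split; [easy|lia].
Qed.

Lemma subdivision_length (l r h : R) (n : nat) (u : nat -> R) :
  Defs.subdivision l r h n u -> r - l = INR n * h.
Proof.
  intros (H0 & Hn & Hstep).
  assert (Hu : forall i, (i <= n)%nat -> u i = l + INR i * h).
  { induction i as [|i IH]; intros Hi; [rewrite H0; simpl; ring|].
    rewrite S_INR. specialize (Hstep i Hi). rewrite IH in Hstep by lia. lra. }
  specialize (Hu n (le_n n)). lra.
Qed.

Lemma subdivision_regular (l h : R) (n : nat) :
  Defs.subdivision l (l + INR n * h) h n (fun i => l + INR i * h).
Proof.
  repeat split; [simpl; ring|]. intros i _. rewrite S_INR. ring.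
Qed.

Section Arcs.
Context (a b c s3 : R) (hab : a > b) (hbc : b > c) (hs3 : sin s3 * cos s3 <> 0).

Lemma half_determined_by_y (e e' : bool) (s1 s2 : R) :
  - s1max a b c < s1 < s1max a b c -> - s2max a b c < s2 < s2max a b c ->
  py (web_param a b c s3 e s1 s2) = py (web_param a b c s3 e' s1 s2) -> e = e'.
Proof.
  intros H1 H2. unfold web_param; cbn [py]. intros Heq.
  assert (Hpos : 0 < sqrt ((a - b) / (b - c))
       * sqrt (1 - (a - c) / (a - b) * (sin s1) ^ 2)
       * sqrt ((a - c) / (a - b) * (cos s2) ^ 2 - 1)).
  { repeat apply Rmult_lt_0_compat; apply sqrt_lt_R0.
    - apply Rdiv_lt_0_compat; lra.
    - now apply radicand1_gt0.
    - now apply radicand2_gt0. }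
  destruct e, e'; unfold half_sign in Heq; auto; lra.
Qed.

(** The midpoint s2 = 0 has z = 0, which on any s1-constant arc happens only at
    its own midpoint, because cos s1 > 0. There x gives s1 back, and y gives the
    half unless the arc is on the common boundary. *)
Lemma s1_const_arc_determined_by_midpoint (e e' : bool) (s1 s1' t : R) :
  - s1max a b c <= s1 <= s1max a b c -> - s1max a b c <= s1' <= s1max a b c ->
  - s2max a b c <= t <= s2max a b c ->
  web_param a b c s3 e s1 0 = web_param a b c s3 e' s1' t ->
  s1 = s1' /\ (- s1max a b c < s1 < s1max a b c -> e = e').
Proof.
  intros H1 H1' Ht Heq.
  pose proof (s1max_bounds a b c hab hbc). pose proof (s2max_bounds a b c hab hbc).
  destruct (sin_cos_s3_neq0 s3 hs3) as [Hs Hc].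
  pose proof (amplitude_pos a b c hab hbc) as HK.
  assert (Hc1 : 0 < cos s1') by (apply cos_gt_0; lra).
  assert (Ht0 : t = 0).
  { apply sin_inj; try lra. rewrite sin_0.
    apply (f_equal pz) in Heq. cbn [pz web_param] in Heq. fold (amplitude a b c) in Heq.
    rewrite sin_0 in Heq.
    apply (Rmult_eq_reg_l (amplitude a b c * cos s1' * sin s3)).
    - lra.
    - repeat (apply Rmult_integral_contrapositive_currified; [|lra]). lra. }
  subst t.
  assert (Hs1 : s1 = s1').
  { apply sin_inj; try lra.
    apply (f_equal px) in Heq. cbn [px web_param] in Heq. fold (amplitude a b c) in Heq.
    rewrite cos_0 in Heq.
    apply (Rmult_eq_reg_l (amplitude a b c * cos s3)).
    - lra.
    - apply Rmult_integral_contrapositive_currified; lra. }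
  subst s1'. split; [easy|]. intros Hint.
  apply (half_determined_by_y e e' s1 0); try lra. now rewrite Heq.
Qed.

Lemma s2_const_arc_determined_by_midpoint (e e' : bool) (s2 s2' t : R) :
  - s2max a b c <= s2 <= s2max a b c -> - s2max a b c <= s2' <= s2max a b c ->
  - s1max a b c <= t <= s1max a b c ->
  web_param a b c s3 e 0 s2 = web_param a b c s3 e' t s2' ->
  s2 = s2' /\ (- s2max a b c < s2 < s2max a b c -> e = e').
Proof.
  intros H2 H2' Ht Heq.
  pose proof (s1max_bounds a b c hab hbc). pose proof (s2max_bounds a b c hab hbc).
  destruct (sin_cos_s3_neq0 s3 hs3) as [Hs Hc].
  pose proof (amplitude_pos a b c hab hbc) as HK.
  assert (Hc2 : 0 < cos s2') by (apply cos_gt_0; lra).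
  assert (Ht0 : t = 0).
  { apply sin_inj; try lra. rewrite sin_0.
    apply (f_equal px) in Heq. cbn [px web_param] in Heq. fold (amplitude a b c) in Heq.
    rewrite sin_0 in Heq.
    apply (Rmult_eq_reg_l (amplitude a b c * cos s2' * cos s3)).
    - lra.
    - repeat (apply Rmult_integral_contrapositive_currified; [|lra]). lra. }
  subst t.
  assert (Hs2 : s2 = s2').
  { apply sin_inj; try lra.
    apply (f_equal pz) in Heq. cbn [pz web_param] in Heq. fold (amplitude a b c) in Heq.
    rewrite cos_0 in Heq.
    apply (Rmult_eq_reg_l (amplitude a b c * sin s3)).
    - lra.
    - apply Rmult_integral_contrapositive_currified; lra. }
  subst s2'. split; [easy|]. intros Hint.
  apply (half_determined_by_y e e' 0 s2); try lra. now rewrite Heq.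
Qed.

Lemma halves_agree (s1 s2 : R) :
  s1 = - s1max a b c \/ s1 = s1max a b c \/
  s2 = - s2max a b c \/ s2 = s2max a b c ->
  web_param a b c s3 true s1 s2 = web_param a b c s3 false s1 s2.
Proof.
  intros Hs. unfold web_param. f_equal.
  rewrite (radicand1_factored a b c s1 hab hbc), (radicand2_factored a b c s2 hab hbc).
  destruct Hs as [-> | [-> | [-> | ->]]];
    rewrite ?Rplus_opp_r, ?Rminus_diag, ?sin_0, ?Rmult_0_l, ?Rmult_0_r, ?sqrt_0; ring.
Qed.

Lemma regular_subdivision_range (m h : R) (M i : nat) :
  0 < h -> INR M * h = 2 * m -> (i <= M)%nat ->
  - m <= - m + INR i * h <= m /\
  ((0 < i < M)%nat -> - m < - m + INR i * h < m).
Proof.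
  intros Hh HM Hi. apply le_INR in Hi as Hi'. pose proof (pos_INR i). split.
  - nra.
  - intros [Hi0 HiM]. apply lt_INR in Hi0, HiM. simpl in Hi0. nra.
Qed.

Lemma regular_subdivision_inj (m h : R) (i j : nat) :
  0 < h -> m + INR i * h = m + INR j * h -> i = j.
Proof.
  intros Hh Heq. apply INR_eq, (Rmult_eq_reg_r h); lra.
Qed.

Lemma s1_const_arcs_card (h : R) (M : nat) :
  (0 < M)%nat -> 0 < h -> INR M * h = 2 * s1max a b c ->
  has_card (s1_const_arcs a b c s3 M (fun i => - s1max a b c + INR i * h)) (2 * M).
Proof.
  intros HM Hh HMh.
  pose proof (s2max_bounds a b c hab hbc).
  apply (has_card_two_sheets (fun e i => arc (fun s2 =>
    web_param a b c s3 e (- s1max a b c + INR i * h) s2)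
    (- s2max a b c) (s2max a b c))); [easy| | |].
  - f_equal. extensionality s2. apply halves_agree. left. simpl; ring.
  - f_equal. extensionality s2. apply halves_agree. right; left. lra.
  - intros e i e' j Hi Hj HF.
    destruct (regular_subdivision_range _ h M i Hh HMh Hi) as [Ri Si].
    destruct (regular_subdivision_range _ h M j Hh HMh Hj) as [Rj _].
    assert (Hpt : arc (fun s2 => web_param a b c s3 e (- s1max a b c + INR i * h) s2)
      (- s2max a b c) (s2max a b c)
      (web_param a b c s3 e (- s1max a b c + INR i * h) 0)).
    { exists 0. split; [lra|easy]. }
    rewrite HF in Hpt. destruct Hpt as (t & Ht & Heq).
    destruct (s1_const_arc_determined_by_midpoint _ _ _ _ _ Ri Rj Ht Heq) as [Hij He].
    split; [|auto]. now apply regular_subdivision_inj in Hij.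
Qed.

Lemma s2_const_arcs_card (h : R) (M : nat) :
  (0 < M)%nat -> 0 < h -> INR M * h = 2 * s2max a b c ->
  has_card (s2_const_arcs a b c s3 M (fun j => - s2max a b c + INR j * h)) (2 * M).
Proof.
  intros HM Hh HMh.
  pose proof (s1max_bounds a b c hab hbc).
  apply (has_card_two_sheets (fun e j => arc (fun s1 =>
    web_param a b c s3 e s1 (- s2max a b c + INR j * h))
    (- s1max a b c) (s1max a b c))); [easy| | |].
  - f_equal. extensionality s1. apply halves_agree. right; right; left. simpl; ring.
  - f_equal. extensionality s1. apply halves_agree. right; right; right. lra.
  - intros e i e' j Hi Hj HF.
    destruct (regular_subdivision_range _ h M i Hh HMh Hi) as [Ri Si].
    destruct (regular_subdivision_range _ h M j Hh HMh Hj) as [Rj _].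
    assert (Hpt : arc (fun s1 => web_param a b c s3 e s1 (- s2max a b c + INR i * h))
      (- s1max a b c) (s1max a b c)
      (web_param a b c s3 e 0 (- s2max a b c + INR i * h))).
    { exists 0. split; [lra|easy]. }
    rewrite HF in Hpt. destruct Hpt as (t & Ht & Heq).
    destruct (s2_const_arc_determined_by_midpoint _ _ _ _ _ Ri Rj Ht Heq) as [Hij He].
    split; [|auto]. now apply regular_subdivision_inj in Hij.
Qed.

(** * Closed samplings from a common step *)

Lemma diagonal_circle (e : bool) (eps delta l r : R) (f g : R -> R) :
  eps = 1 \/ eps = -1 ->
  - (PI / 2) < delta < PI / 2 ->
  (forall t, l <= t <= r -> f t - eps * g t = delta) ->
  exists C, circular_cross_section (ellipsoid a b c s3) C /\
    forall t, l <= t <= r ->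
      - s1max a b c <= f t <= s1max a b c ->
      - s2max a b c <= g t <= s2max a b c ->
      C (web_param a b c s3 e (f t) (g t)).
Proof.
  intros Heps Hd Hfg. eexists. split.
  - apply (diagonal_section_circle a b c s3 hab hbc hs3 eps delta Heps).
    now apply cos_gt_0.
  - intros t Ht Hf Hg. split.
    + apply web_param_on_ellipsoid; auto.
      * now apply radicand1_ge0.
      * now apply radicand2_ge0.
    + rewrite <- (Hfg t Ht). now apply diagonal_plane.
Qed.

(** The diagonals stay off the umbilics, which are the corners of the rectangle
    and the only points with s1 + s2 or s1 - s2 equal to PI/2 or - PI/2: in
    the cell (i, j) the constant lies between - PI/2 + h and PI/2 - h since
    alpha + beta = PI/2. Hence every circle has positive radius. *)
Lemma common_step_closed_sampling (h : R) (M1 M2 : nat) :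
  (0 < M1)%nat -> (0 < M2)%nat -> 0 < h ->
  INR M1 * h = 2 * s1max a b c -> INR M2 * h = 2 * s2max a b c ->
  closed_sampling a b c s3 M1 M2 h
    (fun i => - s1max a b c + INR i * h) (fun j => - s2max a b c + INR j * h).
Proof.
  intros HM1 HM2 Hh H1 H2.
  pose proof (s1max_plus_s2max a b c hab hbc) as Hsum.
  assert (Hcell : forall m M i t, INR M * h = 2 * m -> (i < M)%nat ->
    0 <= t <= h -> - m <= - m + INR i * h + t <= m /\ INR i * h <= 2 * m - h).
  { intros m M i t HM Hi Ht. apply le_INR in Hi. rewrite S_INR in Hi.
    pose proof (pos_INR i). nra. }
  constructor.
  - exact Hh.
  - replace (s1max a b c) with (- s1max a b c + INR M1 * h) at 2 by lra.
    apply subdivision_regular.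
  - replace (s2max a b c) with (- s2max a b c + INR M2 * h) at 2 by lra.
    apply subdivision_regular.
  - intros e i Hi. apply s1_const_line_of_curvature; auto.
    now apply regular_subdivision_range with (M := M1).
  - intros e j Hj. apply s2_const_line_of_curvature; auto.
    now apply regular_subdivision_range with (M := M2).
  - now apply s1_const_arcs_card.
  - now apply s2_const_arcs_card.
  - intros e i j Hi Hj.
    destruct (diagonal_circle e 1
      (- s1max a b c + INR i * h - (- s2max a b c + INR j * h)) 0 h
      (fun t => - s1max a b c + INR i * h + t)
      (fun t => - s2max a b c + INR j * h + t)) as (C & HC & Hin).
    + now left.
    + destruct (Hcell _ _ _ 0 H1 Hi); [lra|]. destruct (Hcell _ _ _ 0 H2 Hj); [lra|].
      lra.
    + intros. ring.
    + exists C. split; [exact HC|]. intros t Ht.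
      apply (Hin t Ht); [now apply Hcell with M1|now apply Hcell with M2].
  - intros e i j Hi Hj.
    destruct (diagonal_circle e (-1)
      (- s1max a b c + INR i * h + (- s2max a b c + INR (S j) * h)) 0 h
      (fun t => - s1max a b c + INR i * h + t)
      (fun t => - s2max a b c + INR (S j) * h - t)) as (C & HC & Hin).
    + now right.
    + rewrite S_INR. pose proof (pos_INR i). pose proof (pos_INR j).
      destruct (Hcell _ _ _ 0 H1 Hi); [lra|]. destruct (Hcell _ _ _ 0 H2 Hj); [lra|].
      nra.
    + intros. ring.
    + exists C. split; [exact HC|]. intros t Ht.
      apply (Hin t Ht); [now apply Hcell with M1|].
      destruct (Hcell _ _ _ (h - t) H2 Hj); [lra|]. rewrite S_INR. lra.
Qed.
End Arcs.

Theorem theorem7p2 (a b c : R) (hab : a > b) (hbc : b > c) (hc : c > 0)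
    (s3 : R) (hs3 : sin s3 * cos s3 <> 0)
    (hE : ~ is_sphere (ellipsoid a b c s3))
    (M1 M2 : nat) (hM1 : (0 < M1)%nat) (hM2 : (0 < M2)%nat) :
  (exists (h : R) (u v : nat -> R), closed_sampling a b c s3 M1 M2 h u v) <->
  sqrt ((a - b) / (a - c)) = cos (INR M2 * PI / (2 * (INR M1 + INR M2))).
Proof.
  pose proof (s1max_plus_s2max a b c hab hbc) as Hsum.
  pose proof (lt_0_INR _ hM1) as HM1. pose proof (lt_0_INR _ hM2) as HM2.
  pose proof PI_RGT_0 as HPI.
  split.
  - intros (h & u & v & [Hh H1 H2 _ _ _ _ _ _]).
    apply subdivision_length in H1. apply subdivision_length in H2.
    assert (Hstep : h = PI / (INR M1 + INR M2)).
    { apply (Rmult_eq_reg_r (INR M1 + INR M2)); [|lra]. field_simplify; lra. }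
    assert (Hs2 : s2max a b c = INR M2 * PI / (2 * (INR M1 + INR M2))).
    { replace (s2max a b c) with (INR M2 * h / 2) by lra.
      rewrite Hstep. field. lra. }
    rewrite <- Hs2. unfold s2max. rewrite cos_acos; [easy|].
    pose proof (modulus_bounds a b c hab hbc). lra.
  - intros Hcos.
    set (h := PI / (INR M1 + INR M2)).
    assert (Hh : 0 < h) by (apply Rdiv_lt_0_compat; lra).
    assert (Htot : INR M1 * h + INR M2 * h = PI) by (unfold h; field; lra).
    assert (Hs2 : INR M2 * h = 2 * s2max a b c).
    { unfold s2max. rewrite Hcos.
      replace (INR M2 * PI / _) with (INR M2 * h / 2) by (unfold h; field; lra).
      rewrite acos_cos; [field|]. nra. }
    eexists h, _, _. apply common_step_closed_sampling; auto. lra.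
Qed.
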